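(* Let $N$ be a positive odd number. Let $n_0=N$, $m_0=2n_0+1=2N+1$, and $l_0=2m_0+1=4N+3$. Let $n_i$, $m_i$, and $l_i$ denote the subsequences of odd numbers in the Collatz sequences of $n_0$, $m_0$, and $l_0$, respectively. Then, for some integer $r\ge 0$, $n_{r+1}=(3n_r+1)/2^k$ with $k>1$. Let $r$ be the smallest such integer (and $k$ the corresponding exponent). Then $m_{r+2}=(3m_{r+1}+1)/2^j$ for some $j>1$, and $$\begin{array}{l} m_i=2n_i+1 \ \text{ for } i\le r,\\ m_{r+1}=2^kn_{r+1}+1,\\ l_i=2m_i+1\ \text{ for } i\le r+1,\\ l_{r+2}=2^jm_{r+2}+1.\end{array}$$ If $k=2$, then $m_i=n_i$ for $i>r+1$. Otherwise, if $k>2$, then $l_{r+2}=4m_{r+2}+1$ and $l_i=m_i$ for $i>r+2$.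
   Context: The Collatz sequence of a positive integer $A$ is $c_0=A$, and for $i\ge1$, $c_i=3c_{i-1}+1$ if $c_{i-1}$ is odd and $c_i=c_{i-1}/2$ if $c_{i-1}$ is even. The subsequence of odd numbers consists of its odd terms in order, indexed from $0$; for odd $A$ its index-$0$ term is $A$. It is infinite: the odd term $1$ is followed by $1,1,1,\dots$. *)

(* Defs.v *)
From mathcomp Require Import all_boot.

Set Implicit Arguments.
Unset Strict Implicit.
Unset Printing Implicit Defensive.

Definition collatz_step (c : nat) : nat := if odd c then 3 * c + 1 else c./2.

Definition collatz (A i : nat) : nat := iter i collatz_step A.

(* [phi] enumerates in increasing order all the positions at which [c] is odd. *)
Definition odd_subsequence (c s : nat -> nat) : Prop :=
  exists phi : nat -> nat,
    [/\ {homo phi : i j / i < j},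
        forall j, odd (c j) <-> exists i, j = phi i
      & forall i, s i = c (phi i)].

(* [b = (3 a + 1) / 2 ^ k] as an exact quotient: [%/] alone would truncate. *)
Definition odd_step (k a b : nat) : Prop :=
  2 ^ k %| 3 * a + 1 /\ b = (3 * a + 1) %/ 2 ^ k.

Lemma collatz_gt0 A i : 0 < A -> 0 < collatz A i.
Proof.
move=> A0; elim: i => // i; rewrite /collatz iterS /collatz_step.
by case: (iter i _ A) => [|[|c]] //=; case: ifP.
Qed.

Lemma collatz_odd_after A p : 0 < A -> exists j, (p <= j) && odd (collatz A j).
Proof.
move=> A0; have [n] := ubnP (collatz A p); elim: n p => // n IHn p.
rewrite ltnS => le_n; have [op|ep] := boolP (odd (collatz A p)).
  by exists p; rewrite leqnn.
have cS : collatz A p.+1 = (collatz A p)./2.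
  by rewrite {1}/collatz iterS {1}/collatz_step -/(collatz A p) (negPf ep).
have [|j /andP[pj oj]] := IHn p.+1; last by exists j; rewrite (ltnW pj).
rewrite cS (leq_trans _ le_n) // ltn_half_double -addnn.
by rewrite -[X in X < _]addn0 ltn_add2l collatz_gt0.
Qed.

(* The odd terms of a Collatz sequence do form an infinite subsequence, so the
   hypothesis [odd_subsequence (collatz A) s] is satisfiable for every A > 0. *)
Lemma odd_subsequence_collatz A :
  0 < A -> exists s, odd_subsequence (collatz A) s.
Proof.
move=> A0; pose nxt p := ex_minn (collatz_odd_after p A0).
have nxtP p : [/\ p <= nxt p, odd (collatz A (nxt p))
    & forall j, p <= j -> odd (collatz A j) -> nxt p <= j].
  rewrite /nxt; case: ex_minnP => q /andP[pq oq] min_q; split=> // j pj oj.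
  by apply: min_q; rewrite pj.
pose phi := fix phi i := if i is i'.+1 then nxt (phi i').+1 else nxt 0.
have phiS i : phi i < phi i.+1 by case: (nxtP (phi i).+1).
exists (fun i => collatz A (phi i)), phi; split=> // [|j].
  exact: homo_ltn ltn_trans phiS.
split=> [oj|[[|i] ->]]; last 2 first.
- by case: (nxtP 0).
- by case: (nxtP (phi i).+1).
have lt_phi i : i <= phi i by elim: i => // i IHi; exact: leq_ltn_trans (phiS i).
have [i] : exists i, j < phi i by exists j.+1; exact: lt_phi.
elim: i => [|i IHi] ltj.
  by case: (nxtP 0) => _ _ /(_ j isT oj); rewrite leqNgt ltj.
case: (ltngtP j (phi i)) => [/IHi //|ltij|->]; last by exists i.
by case: (nxtP (phi i).+1) => _ _ /(_ j ltij oj); rewrite leqNgt ltj.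
Qed.

(* Main.v *)
(* Write [3 n_i + 1 = 2 ^ k * n_(i+1)]. If [m_i = 2 n_i + 1] then
   [3 m_i + 1 = 2 (2 ^ k * n_(i+1) + 1)], so [m_(i+1) = 2 ^ k * n_(i+1) + 1], and the
   relation [m = 2 n + 1] persists exactly as long as [k = 1]; the same computation
   applies to [l] and [m]. At the first [k > 1],
   [3 m_(r+1) + 1 = 4 (3 * 2 ^ (k-2) * n_(r+1) + 1)]: for [k = 2] the bracket is
   [3 n_(r+1) + 1], so [m] merges with [n]; for [k > 2] it is odd, so [j = 2] and
   [l] merges with [m] one step later. Such a [k] occurs because [k = 1] throughout
   would give [2 ^ i * (n_i + 1) = 3 ^ i * (N + 1)], hence [2 ^ i %| N + 1], for all [i]. *)

Require Import Defs.
From mathcomp Require Import all_boot zify.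

Set Implicit Arguments.
Unset Strict Implicit.
Unset Printing Implicit Defensive.

Lemma odd_stepP k a b : odd_step k a b <-> 3 * a + 1 = 2 ^ k * b.
Proof.
rewrite /odd_step; split=> [[dv ->]|->]; first by rewrite [RHS]mulnC divnK.
by rewrite dvdn_mulr // mulKn // expn_gt0.
Qed.

(** The exponent is the 2-adic valuation of the common value. *)
Lemma pow2_odd_inj k j a b :
  odd a -> odd b -> 2 ^ k * a = 2 ^ j * b -> k = j /\ a = b.
Proof.
move=> oa ob e.
have lE t c : odd c -> logn 2 (2 ^ t * c) = t.
  by move=> oc; rewrite mulnC logn_Gauss ?coprime2n // pfactorK.
have ekj : k = j by rewrite -(lE k a oa) e lE.
split=> //; apply/eqP; move/eqP: e; rewrite ekj eqn_mul2l.
by rewrite expn_eq0.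
Qed.

Lemma collatz_halving A p t :
  (forall u, u < t -> ~~ odd (collatz A (p + u))) ->
  collatz A p = 2 ^ t * collatz A (p + t).
Proof.
elim: t => [|t IHt] ev; first by rewrite addn0 mul1n.
rewrite IHt => [|u ltu]; last by apply: ev; exact: ltnW.
have evt := ev t (ltnSn t).
rewrite addnS /collatz iterS -/(collatz A (p + t)) /collatz_step (negPf evt).
by rewrite expnSr -mulnA mul2n even_halfK.
Qed.

(** Frees the odd terms from their positions [phi]. The exponent can stay existential because the
    oddness of [s i.+1] determines it. *)
Definition odd_orbit (s : nat -> nat) : Prop :=
  forall i, odd (s i) /\ exists2 k, 0 < k & 3 * s i + 1 = 2 ^ k * s i.+1.

Lemma odd_subsequence_orbit A s :
  odd A -> odd_subsequence (collatz A) s -> s 0 = A /\ odd_orbit s.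
Proof.
move=> oA [phi [phi_lt phiP sE]].
have oc i : odd (collatz A (phi i)) by apply/phiP; exists i.
have phi_le : {mono phi : i j / i <= j} by apply: leq_mono.
split.
  have [i i0] : exists i, 0 = phi i by apply/(phiP 0).
  rewrite sE; suff -> : phi 0 = 0 by [].
  by apply/eqP; rewrite -leqn0 [X in _ <= X]i0 phi_le.
move=> i; rewrite sE; split=> //.
have cS : collatz A (phi i).+1 = 3 * collatz A (phi i) + 1.
  by rewrite {1}/collatz iterS -/(collatz A (phi i)) /collatz_step oc.
have lt_phi : phi i < phi i.+1 by apply: phi_lt.
(* The exponent counts the halvings after the tripling step; it is positive because [3 * c + 1] is
   even for odd [c]. *)
exists (phi i.+1 - (phi i).+1).
  rewrite subn_gt0 ltn_neqAle lt_phi andbT; apply/eqP => e.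
  by move: (oc i.+1); rewrite -e cS oddD oddM oc.
rewrite sE -cS (@collatz_halving _ _ (phi i.+1 - (phi i).+1)) ?subnKC //.
(* An odd term in between would sit at some [phi j] with [i < j < i.+1]. *)
move=> u ltu; apply/negP => /phiP [j ej].
have : phi i < phi j by lia.
have : phi j < phi i.+1 by lia.
by rewrite !(leqW_mono phi_le); lia.
Qed.

Lemma odd_orbit_next s i k b :
  odd_orbit s -> odd b -> 3 * s i + 1 = 2 ^ k * b -> s i.+1 = b.
Proof.
move=> os ob e; have [_ [k' _ e']] := os i; have [oS _] := os i.+1.
by have [] := @pow2_odd_inj k' k (s i.+1) b oS ob (etrans (esym e') e).
Qed.

Lemma odd_orbit_merge s t i0 :
  odd_orbit s -> odd_orbit t -> s i0 = t i0 -> forall i, i0 <= i -> s i = t i.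
Proof.
move=> os ot e0; elim=> [|i IHi]; first by rewrite leqn0 => /eqP <-.
rewrite leq_eqVlt => /predU1P [<- //|/IHi ei].
have [_ [k _ ek]] := ot i; have [oS _] := ot i.+1.
by apply: odd_orbit_next os oS _; rewrite ei; exact: ek.
Qed.

(** Since [0 < k], the number [2 ^ k * s i.+1 + 1] is odd, so a single halving of [3 * t i + 1]
    reaches it. *)
Lemma odd_orbit_double_next s t i k :
  odd_orbit t -> 0 < k ->
  3 * s i + 1 = 2 ^ k * s i.+1 -> t i = 2 * s i + 1 ->
  t i.+1 = 2 ^ k * s i.+1 + 1.
Proof.
move=> ot k0 ek ti; apply: (odd_orbit_next (k := 1)) ot _ _.
  by rewrite addn1 /= oddM oddX; case: k k0 {ek}.
by rewrite ti; lia.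
Qed.

Lemma odd_orbit_double s t r :
  odd_orbit t -> t 0 = 2 * s 0 + 1 ->
  (forall i, i < r -> 3 * s i + 1 = 2 * s i.+1) ->
  forall i, i <= r -> t i = 2 * s i + 1.
Proof.
move=> ot t0 step; elim=> [//|i IHi] ltir.
by apply: (odd_orbit_double_next (k := 1)) => //; [exact: step | exact/IHi/ltnW].
Qed.

Lemma odd_orbit_exists_step_gt1 s :
  odd_orbit s -> exists r k, 1 < k /\ 3 * s r + 1 = 2 ^ k * s r.+1.
Proof.
move=> os; pose a := s 0 + 1.
have key i : (exists r k, 1 < k /\ 3 * s r + 1 = 2 ^ k * s r.+1) \/
             2 ^ i * (s i + 1) = 3 ^ i * a.
  elim: i => [|i [|IHi]]; [by right | by left |].
  have [_ [[|[|k]] // _ ek]] := os i; last by left; exists i, k.+2.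
  right; rewrite !expnS -!mulnA -IHi mulnCA [RHS]mulnCA; congr (_ * _); lia.
(* At [i = a] the invariant forces [2 ^ a], coprime to [3 ^ a], to divide [a], although
   [0 < a < 2 ^ a]. *)
have [//|e] := key a.
have : 2 ^ a %| a.
  by rewrite -(@Gauss_dvdr _ (3 ^ a)) ?coprimeXl ?coprimeXr // -e dvdn_mulr.
have a0 : 0 < a by rewrite /a addn1.
by move/(dvdn_leq a0); rewrite leqNgt ltn_expl.
Qed.

Theorem theorem2p1 (N : nat) (n m l : nat -> nat)
    (N_gt0 : 0 < N) (N_odd : odd N)
    (n_def : odd_subsequence (collatz N) n)
    (m_def : odd_subsequence (collatz (2 * N + 1)) m)
    (l_def : odd_subsequence (collatz (4 * N + 3)) l) :
  (exists r k : nat, 1 < k /\ odd_step k (n r) (n (r + 1))) /\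
  (forall r k : nat,
     1 < k -> odd_step k (n r) (n (r + 1)) ->
     (forall r' k' : nat,
        1 < k' -> odd_step k' (n r') (n (r' + 1)) -> r <= r') ->
     exists j : nat,
       1 < j /\ odd_step j (m (r + 1)) (m (r + 2)) /\
       (forall i : nat, i <= r -> m i = 2 * n i + 1) /\
       m (r + 1) = 2 ^ k * n (r + 1) + 1 /\
       (forall i : nat, i <= r + 1 -> l i = 2 * m i + 1) /\
       l (r + 2) = 2 ^ j * m (r + 2) + 1 /\
       (k = 2 -> forall i : nat, r + 1 < i -> m i = n i) /\
       (2 < k -> l (r + 2) = 4 * m (r + 2) + 1 /\
                 forall i : nat, r + 2 < i -> l i = m i)).
Proof.
have [n0 on] := odd_subsequence_orbit N_odd n_def.
have [m0 om] : m 0 = 2 * N + 1 /\ odd_orbit m.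
  by apply: odd_subsequence_orbit m_def; lia.
have [l0 ol] : l 0 = 4 * N + 3 /\ odd_orbit l.
  by apply: odd_subsequence_orbit l_def; lia.
split.
  have [r [k [k1 ek]]] := odd_orbit_exists_step_gt1 on.
  by exists r, k; rewrite addn1; split=> //; apply/odd_stepP.
move=> r k k1; rewrite !(addn1 r) !(addn2 r) => /odd_stepP ek min_r.
have n_step i : i < r -> 3 * n i + 1 = 2 * n i.+1.
  move=> ltir; have [_ [[|[|k']] // _ ek']] := on i.
  by have := min_r i k'.+2 isT; rewrite addn1 => /(_ (proj2 (odd_stepP _ _ _) ek')); lia.
have m_n i : i <= r -> m i = 2 * n i + 1.
  by apply: odd_orbit_double n_step i => //; rewrite n0.
have mS : m r.+1 = 2 ^ k * n r.+1 + 1.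
  by apply: odd_orbit_double_next ek _ => //; [exact: ltnW | exact: m_n].
(* For [m] a single halving still occurs at [i = r], one index further than for [n]; hence
   [l = 2 m + 1] lasts up to [r.+1]. *)
have m_step i : i < r.+1 -> 3 * m i + 1 = 2 * m i.+1.
  rewrite ltnS leq_eqVlt => /predU1P [->|ltir]; first by rewrite mS m_n //; lia.
  by have := n_step i ltir; rewrite !m_n ?(ltnW ltir) //; lia.
have l_m i : i <= r.+1 -> l i = 2 * m i + 1.
  by apply: odd_orbit_double m_step i => //; rewrite l0 m0; lia.
have [onS [k' k'0 ek']] := on r.+1; have [onSS _] := on r.+2.
have [j [j1 ej k_eq2 k_gt2]] : exists j, [/\ 1 < j, 3 * m r.+1 + 1 = 2 ^ j * m r.+2,
    k = 2 -> m r.+2 = n r.+2 & 2 < k -> j = 2].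
  have [k2|kn2] := eqVneq k 2.
    (* Two halvings give [3 * n r.+1 + 1], which needs [k'] more, so [j = k' + 2]. *)
    have e : 3 * m r.+1 + 1 = 2 ^ k'.+2 * n r.+2.
      by rewrite mS k2 !expnS; lia.
    have mn := odd_orbit_next om onSS e.
    by exists k'.+2; split; rewrite ?mn ?k2.
  have [t kE] : exists t, k = t.+3 by exists (k - 3); lia.
  (* With [k = t + 3] the cofactor of 4 is visibly odd. *)
  have e : 3 * m r.+1 + 1 = 2 ^ 2 * (2 * (3 * 2 ^ t * n r.+1) + 1).
    by rewrite mS kE !expnS; lia.
  have mE := odd_orbit_next om _ e.
  by exists 2; split=> [//||/eqP|//]; [rewrite mE //; lia | rewrite (negPf kn2)].
have lSS : l r.+2 = 2 ^ j * m r.+2 + 1.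
  by apply: odd_orbit_double_next ej _ => //; [exact: ltnW | exact: l_m].
exists j; split=> //; split; first exact/odd_stepP.
do 5![split=> //].
  by move=> /k_eq2 e i; apply: odd_orbit_merge e i.
move=> /k_gt2 j2; rewrite j2 in lSS; split=> //.
apply: odd_orbit_merge => //.
(* From [l = 4 m + 1] follows [3 l + 1 = 4 (3 m + 1)]: two extra halvings lead to the same odd
   term. *)
have [_ [k3 _ e3]] := om r.+2; have [om3 _] := om r.+3.
apply: (odd_orbit_next (k := k3.+2)) om3 _ => //.
by rewrite lSS !expnS; lia.
Qed.
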